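(* Let $f:\mathbb{A}\to\mathbb{A}$ be a conservative twist map and let $(x_n)_{n\in\mathbb{Z}}$, $x_n=f^n(x)$, be the orbit of a point $x=x_0\in\mathbb{A}$. The following assertions are equivalent: (0) $x\in \mathrm{Green}(f)$; (1) the projection (to $\mathbb{R}$, by $\pi$, of a lift of the orbit) of every finite segment of the orbit of $x$ is locally minimizing for the action among the segments of points of $\mathbb{R}$ that have the same length and the same endpoints; (2) along the orbit of $x$, we have $s_k>s_{-1}$ for every $k\ge 1$; (3) along the orbit of $x$, we have $s_{-k}<s_{1}$ for every $k\ge 1$; (4) there exists a field of half-lines $\delta_+\subset T\mathbb{A}$ along the orbit of $x$ such that $\delta_+$ is invariant by $Df$, i.e. $Df(\delta_+)=\delta_+\circ f$, and $D\pi\circ\delta_+=\mathbb{R}_+$ (i.e. $\delta_+$ is oriented to the right).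
   Context: $\mathbb{T}=\mathbb{R}/\mathbb{Z}$, $\mathbb{A}=\mathbb{T}\times\mathbb{R}$ with coordinates $(\theta,r)$, $p:\mathbb{R}^2\to\mathbb{A}$ is the universal covering, and $\pi(\theta,r)=\theta$ denotes the first projection both on $\mathbb{A}$ and on $\mathbb{R}^2$. Let $\lambda=r\,d\theta$. A conservative twist map is a $C^1$-diffeomorphism $f:\mathbb{A}\to\mathbb{A}$ that is isotopic to the identity, such that there is $\varepsilon>0$ with $\varepsilon<D(\pi\circ f)(x)(0,1)<1/\varepsilon$ for all $x\in\mathbb{A}$ (positive twist), and such that the 1-form $f^*\lambda-\lambda$ is exact. Green set: $V(x)=\{0\}\times\mathbb{R}\subset T_x\mathbb{A}$ is the vertical; for $k\in\mathbb{Z}\setminus\{0\}$, $G_k(x)=Df^k(f^{-k}x)V(f^{-k}x)$; when $G_k(x)$ is transverse to $V(x)$, its slope is denoted $s_k(x)$, i.e. $G_k(x)=\{(\delta\theta,s_k(x)\delta\theta):\delta\theta\in\mathbb{R}\}$. Any inequality involving slopes includes the assertion that these slopes are defined; ''along the orbit of $x$'' means at every point of the orbit of $x$. $\mathrm{Green}(f)$ is the set of $x\in\mathbb{A}$ such that at every point $y$ of the orbit of $x$, for all $n\ge1$, $s_{-n}(y)<s_{-n-1}(y)<s_{n+1}(y)<s_n(y)$. Action: if $F:\mathbb{R}^2\to\mathbb{R}^2$ is a lift of $f$, a generating function of $F$ is a $C^2$ function $S:\mathbb{R}^2\to\mathbb{R}$ with $S(\theta+1,\Theta+1)=S(\theta,\Theta)$,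 $\varepsilon<-\frac{\partial^2S}{\partial\theta\partial\Theta}<\frac1\varepsilon$ for some $\varepsilon>0$, and $F(\theta,r)=(\Theta,R)\iff R=\frac{\partial S}{\partial\Theta}(\theta,\Theta)$ and $r=-\frac{\partial S}{\partial\theta}(\theta,\Theta)$; such an $S$ exists. The action of a finite sequence $(\theta_\ell,\dots,\theta_k)$ of real numbers is $\sum_{j=\ell+1}^{k}S(\theta_{j-1},\theta_j)$. A finite segment $(\theta_\ell,\dots,\theta_k)$ is locally minimizing if it is a local minimum of the action among sequences $(\alpha_\ell,\dots,\alpha_k)$ with $\alpha_\ell=\theta_\ell$, $\alpha_k=\theta_k$. *)

(* Defs.v *)
(* MathComp / MathComp-Analysis, over an arbitrary R : realType. *)
From HB Require Import structures.
From mathcomp Require Import all_boot all_order all_algebra.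
From mathcomp Require Import all_classical all_reals all_analysis.
Import Order.TTheory GRing.Theory Num.Theory.
Import numFieldNormedType.Exports.

Set Implicit Arguments.
Unset Strict Implicit.
Unset Printing Implicit Defensive.

Local Open Scope classical_set_scope.
Local Open Scope ring_scope.

Definition integers (R : realType) : zmodClosed R :=
  GRing.ZmodClosed.clone R (@Num.int_num_subdef R) _.

Definition circle (R : realType) : Type :=
  quotient_topology (Quotient.quot (integers R)).
HB.instance Definition _ (R : realType) := Topological.on (circle R).
HB.instance Definition _ (R : realType) := Quotient.on (circle R).

Definition annulus (R : realType) : Type := (circle R * R)%type.
HB.instance Definition _ (R : realType) := Topological.on (annulus R).

Section Annulus.
Variable R : realType.
Local Notation T := (circle R).
Local Notation A := (annulus R).
Local Notation R2 := (R * R)%type.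

Definition covering (z : R2) : A := (\pi_T z.1 : T, z.2)%qT.

(* The tangent bundle of A is A * R2, trivialised by the frame
   (d/dtheta, d/dr).  At every point x, [local_param x] is the local inverse
   of the chart [local_chart x]; both are p : R2 -> A in coordinates centred
   at x, so that the Jacobian of every change of charts is the identity. *)
Definition local_param (x : A) (v : R2) : A :=
  covering (repr x.1 + v.1, x.2 + v.2).

(* The representative modulo 1 of t in [-1/2, 1/2[. *)
Definition centered (t : R) : R := t - (Num.floor (t + 2^-1))%:~R.

Definition local_chart (x y : A) : R2 :=
  (centered (repr y.1 - repr x.1), y.2 - x.2).

Definition local_expr (f : A -> A) (x : A) (v : R2) : R2 :=
  local_chart (f x) (f (local_param x v)).

Definition Df (f : A -> A) (x : A) : R2 -> R2 := 'd (local_expr f x) (0 : R2).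

Definition C1_annulus (f : A -> A) : Prop :=
  (forall x, differentiable (local_expr f x) (0 : R2)) /\
  (forall v, continuous (fun x => Df f x v)).

Record C1_diffeo := C1Diffeo {
  diffeo_fun :> A -> A;
  diffeo_inv : A -> A;
  diffeo_funK : cancel diffeo_fun diffeo_inv;
  diffeo_invK : cancel diffeo_inv diffeo_fun;
  diffeo_fun_C1 : C1_annulus diffeo_fun;
  diffeo_inv_C1 : C1_annulus diffeo_inv }.

Definition iterz (f : C1_diffeo) (k : int) : A -> A :=
  match k with
  | Posz n => iter n (diffeo_fun f)
  | Negz n => iter n.+1 (diffeo_inv f)
  end.

Definition orbit_of (f : C1_diffeo) (x : A) : set A :=
  range (fun k : int => iterz f k x).

Definition homeomorphism (h : A -> A) : Prop :=
  continuous h /\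
  exists g : A -> A, [/\ cancel h g, cancel g h & continuous g].

(* Isotopy through homeomorphisms, the weakest form of the hypothesis. *)
Definition isotopic_to_id (f : A -> A) : Prop :=
  exists H : R * A -> A,
    [/\ {within `[0, 1]%classic `*` setT, continuous H},
        (forall t : R, 0 <= t <= 1 -> homeomorphism (fun x => H (t, x))),
        (forall x, H (0, x) = x) &
        (forall x, H (1, x) = f x)].

Definition positive_twist (f : A -> A) : Prop :=
  exists2 e : R, 0 < e & forall x, e < (Df f x (0, 1)).1 < e^-1.

Definition one_form : Type := A -> R2 -> R.

Definition liouville : one_form := fun x v => x.2 * v.1.

Definition pullback (f : A -> A) (w : one_form) : one_form :=
  fun x v => w (f x) (Df f x v).

Definition exact_form (w : one_form) : Prop :=
  exists u : A -> R, forall x,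
    differentiable (u \o local_param x) (0 : R2) /\
    forall v, 'd (u \o local_param x) (0 : R2) v = w x v.

Definition conservative_twist_map (f : C1_diffeo) : Prop :=
  [/\ isotopic_to_id f, positive_twist f &
      exact_form (fun x v => pullback f liouville x v - liouville x v)].

Definition vertical : set R2 := [set v | v.1 = 0].

Definition green_line (f : C1_diffeo) (k : int) (x : A) : set R2 :=
  Df (iterz f k) (iterz f (- k) x) @` vertical.

Definition is_slope (f : C1_diffeo) (k : int) (x : A) (s : R) : Prop :=
  green_line f k x = [set (d, s * d) | d in [set: R]].

(* s_k(x) < s_l(x), both slopes being defined. *)
Definition slope_lt (f : C1_diffeo) (x : A) (k l : int) : Prop :=
  exists s t : R, [/\ is_slope f k x s, is_slope f l x t & s < t].

Definition green_set (f : C1_diffeo) : set A :=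
  [set x | forall y, orbit_of f x y -> forall n : nat, (1 <= n)%N ->
    [/\ slope_lt f y (- n%:Z) (- n.+1%:Z),
        slope_lt f y (- n.+1%:Z) n.+1%:Z &
        slope_lt f y n.+1%:Z n%:Z]].

Definition is_lift (F : R2 -> R2) (f : A -> A) : Prop :=
  continuous F /\ forall z, covering (F z) = f (covering z).

Definition C1_plane (u : R2 -> R) : Prop :=
  (forall z, differentiable u z) /\ (forall v, continuous ('D_v u)).

Definition C2_plane (u : R2 -> R) : Prop :=
  C1_plane u /\ forall v, C1_plane ('D_v u).

Definition d1 (u : R2 -> R) : R2 -> R := 'D_((1, 0) : R2) u.
Definition d2 (u : R2 -> R) : R2 -> R := 'D_((0, 1) : R2) u.

Definition generating_function (S : R2 -> R) (F : R2 -> R2) : Prop :=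
  [/\ C2_plane S,
      (forall a b, S (a + 1, b + 1) = S (a, b)),
      (exists2 e : R, 0 < e & forall z, e < - d1 (d2 S) z < e^-1) &
      (forall a r b q, F (a, r) = (b, q) <->
         q = d2 S (a, b) /\ r = - d1 S (a, b))].

(* A finite sequence of n + 1 reals is a row vector of length n + 1. *)
Definition action (S : R2 -> R) (n : nat) (a : 'rV[R]_n.+1) : R :=
  \sum_(i < n) S (a 0 (widen_ord (leqnSn n) i), a 0 (lift ord0 i)).

Definition locally_minimizing (S : R2 -> R) (n : nat) (a : 'rV[R]_n.+1) : Prop :=
  nbhs a [set b : 'rV[R]_n.+1 |
    b 0 ord0 = a 0 ord0 -> b 0 ord_max = a 0 ord_max ->
    action S a <= action S b].

Definition orbit_lift (F : R2 -> R2) (f : C1_diffeo) (x : A)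
    (X : int -> R2) : Prop :=
  (forall k, X (k + 1) = F (X k)) /\ (forall k, covering (X k) = iterz f k x).

(* (theta_l, ..., theta_(l + n)) *)
Definition projected_segment (X : int -> R2) (l : int) (n : nat) : 'rV[R]_n.+1 :=
  \row_(i < n.+1) (X (l + (i : nat)%:Z)).1.

Definition half_line (D : set R2) : Prop :=
  exists2 v : R2, v != 0 & D = [set t *: v | t in [set t : R | 0 <= t]].

Definition invariant_half_line_field (f : C1_diffeo) (x : A)
    (delta : A -> set R2) : Prop :=
  forall y, orbit_of f x y ->
    [/\ half_line (delta y),
        Df f y @` delta y = delta (f y) &
        fst @` delta y = [set t : R | 0 <= t]].

End Annulus.

(* Main.v *)
Require Import Defs.
From mathcomp Require Import all_boot all_order all_algebra.
From mathcomp Require Import all_classical all_reals all_analysis.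
From mathcomp Require Import ring lra zify.
Import Order.TTheory GRing.Theory Num.Theory.
Import numFieldNormedType.Exports.
Set Implicit Arguments.
Unset Strict Implicit.
Unset Printing Implicit Defensive.
Local Open Scope classical_set_scope.
Local Open Scope ring_scope.

(* Along the orbit of x let b i j be the first coordinate of
   Df^(j-i) (0, 1) based at the i-th point.  Since Df has determinant 1 (read
   off the symmetric Hessian of S), b is antisymmetric and the slopes at the
   m-th point satisfy
     s_l - s_k = b (m-k) (m-l) / (b (m-k) m * b (m-l) m).
   Each of (0), (2), (3) thus turns into a sign condition on b, equivalent to
   "b i j > 0 whenever i < j", i.e. to the absence of conjugate points.
   Under this condition s_n decreases to a slope, which spans an invariant field
   of half-lines; conversely the Wronskian with an invariant half-line stays
   positive, which forces b i j > 0.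
   For (1), the quotients of consecutive b's are the pivots of the tridiagonal
   second variation of the action.  Positive pivots stay positive for nearby
   segments, so the action is convex along short straight lines issued from the
   orbit segment; a nonpositive pivot gives, after adding one more vertex, a
   direction of negative second variation. *)

(** * Charts of the annulus, the chain rule, and iterates of [f] *)

Section AnnulusCalculus.
Variable R : realType.
Local Notation A := (annulus R).
Local Notation R2 := (R * R)%type.

Lemma covering_eq (z z' : R2) :
  covering z = covering z' <-> (exists m : int, z.1 - z'.1 = m%:~R) /\ z.2 = z'.2.
Proof.
split.
  case=> h1 h2; split=> //.
  have /eqP : (z.1 = z'.1 %[mod {ideal_quot (integers R)}])%qT by exact: h1.
  by rewrite -Quotient.idealrBE => /intrP.
case=> -[m hm] h2; congr (_, _) => //.
have /eqP : (z.1 == z'.1 %[mod {ideal_quot (integers R)}])%qT.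
  by rewrite -Quotient.idealrBE; apply/intrP; exists m.
exact.
Qed.

Lemma covering_repr (y : A) : covering (repr y.1, y.2) = y.
Proof. by case: y => y1 y2; rewrite /covering /= reprK. Qed.

Lemma centeredDz (t : R) (m : int) : centered (t + m%:~R) = centered t.
Proof.
rewrite /centered (addrAC t _ 2^-1).
have -> : Num.floor (t + 2^-1 + m%:~R) = Num.floor (t + 2^-1) + m.
  by rewrite floorDrz ?num_real ?intrKfloor// intr_int.
by rewrite intrD opprD addrACA subrr addr0.
Qed.

Lemma centered_small (t : R) : `|t| < 2^-1 -> centered t = t.
Proof.
rewrite ltr_norml => /andP[h1 h2]; rewrite /centered (@floor_def _ _ 0) ?subr0//.
by apply/andP; split; lra.
Qed.

Lemma local_paramK (y z : A) : local_param y (local_chart y z) = z.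
Proof.
rewrite -[RHS]covering_repr; apply/covering_eq; split=> /=; last by rewrite subrKC.
exists (- Num.floor (repr z.1 - repr y.1 + 2^-1)).
rewrite /centered intrN; ring.
Qed.

Lemma local_param0 (y : A) : local_param y 0 = y.
Proof. by rewrite -[RHS]covering_repr /local_param /= !addr0. Qed.

Lemma local_chartxx (y : A) : local_chart y y = 0.
Proof. by rewrite /local_chart !subrr centered_small// normr0 invr_gt0. Qed.

Lemma local_expr0 (f : A -> A) (y : A) : local_expr f y 0 = 0.
Proof. by rewrite /local_expr local_param0 local_chartxx. Qed.

(** This is an equality of functions, not only of germs at 0, because [local_paramK] holds on the
    whole annulus. *)
Lemma local_expr_comp (f g : A -> A) (y : A) :
  local_expr (g \o f) y = local_expr g (f y) \o local_expr f y.
Proof. by apply/funext => v; rewrite /local_expr /= local_paramK. Qed.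

Lemma local_chart_covering (z w : R2) : `|w.1 - z.1| < 2^-1 ->
  local_chart (covering z) (covering w) = w - z.
Proof.
move=> wz; rewrite /local_chart /=.
have repr_covering (u : R2) : exists m : int, repr (covering u).1 = u.1 + m%:~R.
  have /covering_eq[[m hm] _] := covering_repr (covering u).
  by exists m; rewrite -hm /= subrKC.
have [m hm] := repr_covering w; have [k hk] := repr_covering z.
rewrite hm hk.
have -> : w.1 + m%:~R - (z.1 + k%:~R) = w.1 - z.1 + (m - k)%:~R.
  by rewrite intrB; ring.
by rewrite centeredDz centered_small.
Qed.

Lemma local_param_covering (z v : R2) :
  local_param (covering z) v = covering (z + v).
Proof.
have /covering_eq[[m hm] _] := covering_repr (covering z).
apply/covering_eq; split=> //=; exists m; rewrite -hm /=; ring.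
Qed.

Lemma nbhs_norm_fst_small (G : R2 -> R2) : {for 0, continuous G} ->
  \forall v \near (0 : R2), `|(G v).1 - (G 0).1| < 2^-1.
Proof.
move=> /cvgr_dist_lt /(_ 2^-1); rewrite invr_gt0 => /(_ (ltr0n _ 2)).
apply: filterS => v; apply: le_lt_trans; rewrite distrC.
by rewrite [leRHS]/Num.norm/= le_max lexx.
Qed.

(** By continuity the angle of [F (z + v)] stays within 1/2 of that of [F z] for small [v], so
    centring modulo 1 returns the true difference. *)
Lemma local_expr_lift (f : A -> A) (F : R2 -> R2) (z : R2) : is_lift F f ->
  \forall v \near (0 : R2), local_expr f (covering z) v = F (z + v) - F z.
Proof.
case=> cF lF.
have cG : {for 0, continuous (fun v : R2 => F (z + v))}.
  apply: (@continuous_comp _ _ _ (fun v => z + v) F); last exact: cF.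
  by apply: continuousD; [exact: cst_continuous|exact: id].
apply: filterS (nbhs_norm_fst_small cG) => v; rewrite addr0 => hv.
by rewrite /local_expr local_param_covering -!lF local_chart_covering.
Qed.

Lemma local_expr_id (y : A) : \forall v \near (0 : R2), local_expr id y v = v.
Proof.
have lid : is_lift (id : R2 -> R2) (id : A -> A) by split=> // z; exact: id.
have := local_expr_lift (repr y.1, y.2) lid; apply: filterS => v.
by rewrite covering_repr addrAC subrr add0r.
Qed.


Definition annulus_diff (f : A -> A) : Prop :=
  forall y, differentiable (local_expr f y) (0 : R2).

Lemma annulus_diff_comp (f g : A -> A) : annulus_diff f ->
  annulus_diff g -> annulus_diff (g \o f).
Proof.
move=> sf sg y; rewrite local_expr_comp; apply: differentiable_comp; first exact: sf.
by rewrite local_expr0; exact: sg.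
Qed.

Lemma Df_comp (f g : A -> A) (y : A) (v : R2) : annulus_diff f -> annulus_diff g ->
  Df (g \o f) y v = Df g (f y) (Df f y v).
Proof.
move=> sf sg.
have dg : differentiable (local_expr g (f y)) (local_expr f y 0).
  by rewrite local_expr0; exact: sg.
have e := congr1 (@^~ v) (diff_comp (sf y) dg).
rewrite local_expr0 in e.
rewrite /Df local_expr_comp.
exact: e.
Qed.

Lemma Df_id (y : A) (v : R2) : annulus_diff id -> Df id y v = v.
Proof.
move=> sid; rewrite /Df -deriveE//.
rewrite (@near_eq_derive _ _ _ _ id)//; last exact: local_expr_id.
by rewrite derive_id.
Qed.

Variable f : C1_diffeo R.

Lemma annulus_diff_diffeo : annulus_diff f. Proof. exact: (diffeo_fun_C1 f).1. Qed.

Lemma annulus_diff_diffeo_inv : annulus_diff (diffeo_inv f).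
Proof. exact: (diffeo_inv_C1 f).1. Qed.

Lemma annulus_diff_id : annulus_diff id.
Proof.
suff <- : diffeo_inv f \o f = id.
  by apply: annulus_diff_comp; [exact: annulus_diff_diffeo|exact: annulus_diff_diffeo_inv].
by apply/funext => y /=; rewrite diffeo_funK.
Qed.

Lemma annulus_diff_iterz (k : int) : annulus_diff (iterz f k).
Proof.
case: k => n /=; last first.
  elim: n => [|n IHn] /=; first exact: annulus_diff_diffeo_inv.
  exact: (annulus_diff_comp IHn annulus_diff_diffeo_inv).
elim: n => [|n IHn] /=; first exact: annulus_diff_id.
exact: (annulus_diff_comp IHn annulus_diff_diffeo).
Qed.

Lemma iterzS (k : int) (y : A) : iterz f (k + 1) y = f (iterz f k y).
Proof.
case: k => [n|[|n]]; first by rewrite -PoszD addn1.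
  by rewrite /= diffeo_invK.
by rewrite (_ : Negz n.+1 + 1 = Negz n) /= ?diffeo_invK// !NegzE; ring.
Qed.

Lemma iterzD (k l : int) (y : A) : iterz f (k + l) y = iterz f k (iterz f l y).
Proof.
have iterzB m z : iterz f (m - 1) z = diffeo_inv f (iterz f m z).
  by apply: (can_inj (diffeo_funK f)); rewrite -iterzS subrK diffeo_invK.
elim/int_ind: k => [|n IHn|n IHn]; first by rewrite add0r.
  by rewrite -[n.+1]addn1 PoszD addrAC !iterzS IHn.
rewrite -[n.+1]addn1 PoszD opprD addrAC !iterzB IHn //.
Qed.

Lemma Df_iterzD (k l : int) (y : A) (v : R2) :
  Df (iterz f (k + l)) y v = Df (iterz f k) (iterz f l y) (Df (iterz f l) y v).
Proof.
rewrite -Df_comp; [|exact: annulus_diff_iterz..].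
by congr (Df _ y v); apply/funext => z /=; rewrite iterzD.
Qed.

End AnnulusCalculus.

(** * Directional derivatives in the plane and symmetry of second derivatives *)

Section PlaneCalculus.
Variable R : realType.
Local Notation R2 := (R * R)%type.
Implicit Types (u S : R2 -> R) (z v w : R2).

Lemma derive_dirE u z v : differentiable u z ->
  'D_v u z = v.1 * d1 u z + v.2 * d2 u z.
Proof.
move=> du; rewrite /d1 /d2 !deriveE//.
have {1}-> : v = v.1 *: (1, 0) + v.2 *: (0, 1).
  by case: v => a b; congr (_, _); rewrite /= /GRing.scale/= !(mulr1, mulr0) ?addr0 ?add0r.
by rewrite linearD !linearZ.
Qed.

Lemma is_derive_line u z v (t : R) : differentiable u (z + t *: v) ->
  is_derive t 1 (fun s : R => u (z + s *: v)) ('D_v u (z + t *: v)).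
Proof.
move=> du.
have [dl el] : is_derive t (1 : R) (fun s : R => z + s *: v) v.
  have : is_derive t (1 : R) (cst z + (fun s : R => s *: v)) (0 + v).
    apply: is_deriveD.
    have hd : differentiable (fun s : R => s *: v) t.
      exact: (@differentiableZl _ _ _ (@id R) v).
    apply: DeriveDef; first exact: diff_derivable.
    by rewrite deriveE// (@diffZl _ _ _ (@id R)) //= diff_val scale1r.
  by rewrite add0r.
have dl' : differentiable (fun s : R => z + s *: v) t by apply/derivable1_diffP.
have duc := differentiable_comp dl' du.
apply: DeriveDef; first exact: diff_derivable.
by rewrite deriveE// diff_comp//= -[X in 'd u _ X]deriveE// el deriveE.
Qed.

Lemma MVT0 (g dg : R -> R) (h : R) : 0 < h ->
  (forall t : R, is_derive t (1 : R) g (dg t)) ->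
  exists2 c, 0 < c < h & g h - g 0 = dg c * h.
Proof.
move=> h0 dg'.
have cg : {within `[0, h], continuous g}.
  by apply: derivable_within_continuous => t _; apply: ex_derive.
have [c] := MVT h0 (fun t _ => dg' t) cg.
by rewrite subr0 in_itv; exists c.
Qed.

(** Two applications of the mean value theorem: along [v] to the increment of [S] in direction [w],
    then along [w] to ['D_v S]. *)
Lemma second_difference S z v w (h : R) : C2_plane S -> 0 < h ->
  exists s t, [/\ 0 < s < h, 0 < t < h &
    S (z + h *: w + h *: v) - S (z + h *: v) - (S (z + h *: w) - S z) =
    'D_w ('D_v S) (z + s *: v + t *: w) * h * h].
Proof.
move=> [[dS _] dDS] h0.
have dg (t : R) : is_derive t (1 : R)
    (fun s => S (z + h *: w + s *: v) - S (z + s *: v))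
    ('D_v S (z + h *: w + t *: v) - 'D_v S (z + t *: v)).
  by apply: is_deriveB; apply: is_derive_line.
have [s hs] := MVT0 h0 dg; rewrite !scale0r !addr0 => es.
have [t ht] := MVT0 h0 (fun t => @is_derive_line _ (z + s *: v) w t ((dDS v).1 _)).
rewrite scale0r addr0 => et; exists s, t; split=> //.
by rewrite es -et (addrAC z).
Qed.

Lemma ler_dist_half (a b c c' e : R) : c = c' ->
  `|a - c| < e / 2 -> `|b - c'| < e / 2 -> `|a - b| <= e.
Proof.
move=> <-; rewrite !ltr_norml ler_norml => /andP[p1 p2] /andP[p3 p4].
by apply/andP; split; lra.
Qed.

(* Schwarz: the second difference is symmetric in v and w. *)
Lemma derive_comm S z v w : C2_plane S -> 'D_w ('D_v S) z = 'D_v ('D_w S) z.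
Proof.
move=> C2S; apply/eqP; rewrite -subr_eq0 -normr_le0; apply/ler_addgt0Pl => e e0.
rewrite addr0.
have c1 (a b : R2) :
    {for 0, continuous (fun p : R * R => 'D_b ('D_a S) (z + p.1 *: a + p.2 *: b))}.
  have cl c (q : R * R -> R) : {for 0, continuous q} ->
      {for 0, continuous (fun p => q p *: c : R2)}.
    by move=> cq; exact: continuousZr_tmp.
  have cp : {for 0, continuous (fun p : R * R => z + p.1 *: a + p.2 *: b)}.
    by apply: continuousD; [apply: continuousD; [exact: cst_continuous|]|];
      apply: cl; [exact: cvg_fst|exact: cvg_snd].
  exact: (continuous_comp cp ((C2S.2 a).2 b _)).
have e2 : 0 < e / 2 by rewrite divr_gt0.
have near2 (a b : R2) : exists2 d : R, 0 < d & forall p q : R, 0 < p < d -> 0 < q < d ->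
    `|'D_b ('D_a S) z - 'D_b ('D_a S) (z + p *: a + q *: b)| < e / 2.
  have /cvgrPdist_lt /(_ _ e2) /nbhs_ballP[d /= d0 hd] := c1 a b.
  exists d => // p q /andP[p0 pd] /andP[q0 qd].
  have := hd (p, q); rewrite /= !scale0r !addr0; apply.
  by split; rewrite /ball/= sub0r normrN gtr0_norm.
have [d d0 hd] := near2 v w; have [d' d'0 hd'] := near2 w v.
pose h := Num.min d d'.
have h0 : 0 < h by rewrite lt_min d0.
have [s [t [/andP[s0 sh] /andP[t0 th] e1]]] := second_difference z v w C2S h0.
have [s' [t' [/andP[s'0 s'h] /andP[t'0 t'h] e1']]] := second_difference z w v C2S h0.
(* Both sides, times [h * h], are the same second difference. Each is within [e / 2] of its value at
   [z]. *)
have eq12 : 'D_w ('D_v S) (z + s *: v + t *: w) = 'D_v ('D_w S) (z + s' *: w + t' *: v).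
  apply: (mulIf (lt0r_neq0 h0)); apply: (mulIf (lt0r_neq0 h0)).
  have e3 : z + h *: v + h *: w = z + h *: w + h *: v by exact: addrAC.
  apply: (etrans (esym e1)); apply: etrans e1'; rewrite e3.
  have aux (p a b c : R) : p - a - (b - c) = p - b - (a - c) by ring.
  exact: aux.
have hl r : r < h -> r < d by move=> rh; apply: lt_le_trans rh _; rewrite ge_min lexx.
have hr r : r < h -> r < d' by move=> rh; apply: lt_le_trans rh _; rewrite ge_min lexx orbT.
apply: (ler_dist_half eq12).
  by apply: hd; apply/andP; [exact: conj s0 (hl _ sh)|exact: conj t0 (hl _ th)].
by apply: hd'; apply/andP; [exact: conj s'0 (hr _ s'h)|exact: conj t'0 (hr _ t'h)].
Qed.

End PlaneCalculus.

(** * The differential of [f] in terms of the Hessian of [S] *)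

Section GeneratingFunction.
Variable R : realType.
Local Notation R2 := (R * R)%type.
Variables (f : C1_diffeo R) (F : R2 -> R2) (S : R2 -> R).
Hypotheses (hF : is_lift F f) (hS : generating_function S F).

Lemma generating_lift (z : R2) :
  (F z).2 = d2 S (z.1, (F z).1) /\ z.2 = - d1 S (z.1, (F z).1).
Proof. by case: hS => _ _ _ h; apply/h; rewrite -!surjective_pairing. Qed.

Lemma generating_C2 : C2_plane S. Proof. by case: hS. Qed.

Lemma d1d2_sym (w : R2) : d2 (d1 S) w = d1 (d2 S) w.
Proof. exact: derive_comm generating_C2. Qed.

Lemma cross_gt0 (w : R2) : 0 < - d1 (d2 S) w.
Proof. by case: hS => _ _ [e e0 he] _; have /andP[/(lt_trans e0)] := he w. Qed.

Lemma differentiable_d1 (w : R2) : differentiable (d1 S) w.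
Proof. exact: (generating_C2.2 _).1. Qed.

Lemma differentiable_d2 (w : R2) : differentiable (d2 S) w.
Proof. exact: (generating_C2.2 _).1. Qed.

Lemma differentiable_fst (z : R2) : differentiable (fst : R2 -> R) z.
Proof. by apply: (@linear_differentiable _ _ _ fst) => p; exact: cvg_fst. Qed.

Lemma differentiable_snd (z : R2) : differentiable (snd : R2 -> R) z.
Proof. by apply: (@linear_differentiable _ _ _ snd) => p; exact: cvg_snd. Qed.

(** Differentiate [r = - d1 S] and [R = d2 S] along [v]. A lift is only assumed continuous, so its
    increment is replaced near 0 by the differentiable [L]; [K u] is then the pair of angles of
    [z + u] and [F (z + u)]. *)
Lemma Df_generating (z v : R2) :
  let w := (z.1, (F z).1) in let m := Df f (covering z) v in
  v.2 = - (v.1 * d1 (d1 S) w + m.1 * d1 (d2 S) w) /\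
  m.2 = v.1 * d1 (d2 S) w + m.1 * d2 (d2 S) w.
Proof.
move=> w m.
pose L := local_expr f (covering z).
have dL : differentiable L (0 : R2) := annulus_diff_diffeo f (covering z).
have L0 : L 0 = 0 by exact: local_expr0.
have dL1 : is_diff (0 : R2) (fst \o L) (fst \o 'd L (0 : R2)).
  have dF := differentiable_comp dL (differentiable_fst (L 0)).
  apply: DiffDef; first exact: dF.
  rewrite (diff_comp dL (differentiable_fst (L 0))).
  by rewrite (@diff_lin _ _ _ fst) // => p; exact: cvg_fst.
pose K u := (z.1, (F z).1) + (u.1, (L u).1) : R2.
have dfst : is_diff (0 : R2) (fst : R2 -> R) fst.
  apply: DiffDef; first exact: differentiable_fst.
  by rewrite (@diff_lin _ _ _ fst) // => p; exact: cvg_fst.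
have [dK0 eK] := is_diffD (is_diff_cst (z.1, (F z).1) (0 : R2)) (is_diff_pair dfst dL1).
have dK : differentiable K (0 : R2) := dK0.
have dKE : 'd K (0 : R2) v = (v.1, m.1).
  by rewrite eK /= add0r.
have K0 : K 0 = w by rewrite /K L0 addr0.
have derK (u : R2 -> R) : differentiable u w ->
    is_derive (0 : R2) v (u \o K) (v.1 * d1 u w + m.1 * d2 u w).
  rewrite -K0 => du; have duK := differentiable_comp dK du.
  apply: DeriveDef; first exact: diff_derivable.
  by rewrite (deriveE _ duK) (diff_comp dK du) /= dKE -deriveE// derive_dirE.
have KE : \forall u \near (0 : R2),
    F (z + u) = F z + L u /\ K u = ((z + u).1, (F (z + u)).1).
  apply: filterS (local_expr_lift z hF) => u Lu.
  have FE : F (z + u) = F z + L u by rewrite /L Lu subrKC.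
  by split; last rewrite FE.
split.
  have snd' : is_derive (0 : R2) v (cst z.2 + (snd : R2 -> R)) (0 + v.2).
    apply: is_deriveD; apply: DeriveDef; first exact/diff_derivable/differentiable_snd.
    rewrite deriveE ?(@diff_lin _ _ _ snd)//; first by move=> p; exact: cvg_snd.
    exact: differentiable_snd.
  have d1K := is_deriveN (derK _ (differentiable_d1 w)).
  have E : \forall u \near (0 : R2), (- (d1 S \o K)) u = (cst z.2 + (snd : R2 -> R)) u.
    by apply: filterS KE => u [_ Ku]; change (- d1 S (K u) = (z + u).2);
      rewrite Ku; case: (generating_lift (z + u)).
  have [_ e1] := near_eq_is_derive E d1K; have [_ e2] := snd'.
  have := etrans (esym e2) e1; rewrite add0r => ->.
  exact: (congr1 (fun t => - (v.1 * d1 (d1 S) w + m.1 * t)) (d1d2_sym w)).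
have sL : is_derive (0 : R2) v (cst (F z).2 + (snd \o L)) (0 + m.2).
  apply: is_deriveD; have dsL := differentiable_comp dL (differentiable_snd (L 0)).
  apply: DeriveDef; first exact/diff_derivable/dsL.
  rewrite (deriveE _ dsL) (diff_comp dL (differentiable_snd (L 0))).
  by rewrite (@diff_lin _ _ _ snd) // => p; exact: cvg_snd.
have d2K := derK _ (differentiable_d2 w).
have E2 : \forall u \near (0 : R2), (d2 S \o K) u = (cst (F z).2 + (snd \o L)) u.
  apply: filterS KE => u [FE Ku]; change (d2 S (K u) = (F z + L u).2); rewrite Ku.
  by have [<- _] := generating_lift (z + u); rewrite FE.
have [_ e1] := near_eq_is_derive E2 d2K; have [_ e2] := sL.
by have := etrans (esym e2) e1; rewrite add0r => ->.
Qed.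

End GeneratingFunction.

(** * Transported verticals, Green slopes and conjugate points *)

Section Cocycle.
Variable R : realType.
Local Notation A := (annulus R).
Local Notation R2 := (R * R)%type.

Definition wedge (u v : R2) : R := u.1 * v.2 - u.2 * v.1.

Lemma wedgeC (u v : R2) : wedge u v = - wedge v u.
Proof. by rewrite /wedge; ring. Qed.

Lemma Df_linear (g : A -> A) (y : A) (s t : R) (u v : R2) :
  Df g y (s *: u + t *: v) = s *: Df g y u + t *: Df g y v.
Proof. by rewrite /Df linearD !linearZ. Qed.

Lemma Df_scale (g : A -> A) (y : A) (s : R) (u : R2) :
  Df g y (s *: u) = s *: Df g y u.
Proof. by rewrite /Df linearZ. Qed.

Lemma Df_expand (g : A -> A) (y : A) (v : R2) :
  Df g y v = v.1 *: Df g y (1, 0) + v.2 *: Df g y (0, 1).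
Proof.
rewrite -Df_linear; congr (Df g y _); case: v => a b.
by congr (_, _); rewrite /= /GRing.scale/= !(mulr1, mulr0) ?addr0 ?add0r.
Qed.

Variable f : C1_diffeo R.
Hypothesis det1 : forall y, wedge (Df f y (1, 0)) (Df f y (0, 1)) = 1.
Hypothesis twist : forall y, 0 < (Df f y (0, 1)).1.

Lemma wedge_Df y u v : wedge (Df f y u) (Df f y v) = wedge u v.
Proof.
have := det1 y; rewrite (Df_expand _ _ u) (Df_expand _ _ v) /wedge.
move: (Df f y (1, 0)) (Df f y (0, 1)) => [a c] [b d] /= e.
transitivity ((u.1 * v.2 - u.2 * v.1) * (a * d - c * b)); last by rewrite e mulr1.
rewrite /GRing.scale /=; ring.
Qed.

Lemma wedge_Df_iterz k y u v :
  wedge (Df (iterz f k) y u) (Df (iterz f k) y v) = wedge u v.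
Proof.
have Dfid z w : Df (iterz f 0) z w = w by exact: Df_id (annulus_diff_id f).
have nat_case (n : nat) z u' v' :
    wedge (Df (iterz f n) z u') (Df (iterz f n) z v') = wedge u' v'.
  elim: n => [|n IHn]; first by rewrite !Dfid.
  rewrite -[n.+1]add1n PoszD !Df_iterzD.
  by rewrite (wedge_Df (iterz f n z)) IHn.
case: (intP k) => [|n|n]; [exact: (nat_case 0%N)|exact: nat_case|].
(* A negative iterate reduces to a positive one: applying [Df] of the opposite iterate preserves the
   wedge and brings both vectors back. *)
rewrite -(nat_case n.+1 (iterz f (- n.+1%:Z) y)) -!Df_iterzD addrN !Dfid //.
Qed.

Variable x : A.

(** A vector spanning the Green line G_(j-i) at the j-th point of the orbit. *)
Definition transported_vertical (i j : int) : R2 :=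
  Df (iterz f (j - i)) (iterz f i x) (0, 1).

Local Notation V := transported_vertical.

(* Up to normalization, j |-> jacobi i j is the Jacobi field vanishing at i.
   Locked: unification must not unfold it down to differentials. *)
Definition jacobi (i j : int) : R := locked (V i j).1.

Local Notation b := jacobi.

Lemma jacobiE i j : b i j = (V i j).1. Proof. by rewrite /jacobi -lock. Qed.

Lemma transport_vertical i j k : Df (iterz f (k - j)) (iterz f j x) (V i j) = V i k.
Proof.
rewrite /V (_ : iterz f j x = iterz f (j - i) (iterz f i x)); last by rewrite -iterzD subrK.
by rewrite -Df_iterzD addrA subrK.
Qed.

Lemma transported_verticalxx i : V i i = (0, 1).
Proof. by rewrite /V subrr Df_id //; exact: (annulus_diff_id f). Qed.

(** The wedge is invariant, so it may be computed at the j-th point, where the second vector is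
    [(0, 1)]. *)
Lemma wedge_vertical i j k : wedge (V i k) (V j k) = b i j.
Proof.
rewrite -(transport_vertical i j k) -(transport_vertical j j k) wedge_Df_iterz.
by rewrite transported_verticalxx /wedge jacobiE /= mulr1 mulr0 subr0.
Qed.

Lemma jacobiC i j : b j i = - b i j.
Proof. by rewrite -(wedge_vertical j i i) wedgeC wedge_vertical. Qed.

Lemma jacobi_succ_gt0 i : 0 < b i (i + 1).
Proof. by rewrite jacobiE /V addrAC subrr add0r; exact: twist. Qed.

Lemma is_slopeP k m s : is_slope f k (iterz f m x) s <->
  b (m - k) m != 0 /\ s = (V (m - k) m).2 / b (m - k) m.
Proof.
rewrite /is_slope /green_line -iterzD (addrC (- k)).
have -> : iterz f k = iterz f (m - (m - k)) by rewrite opprB addrC subrK.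
rewrite -/(V _ _).
have -> : Df (iterz f (m - (m - k))) (iterz f (m - k) x) @` @vertical R =
    [set t *: V (m - k) m | t in [set: R]].
  apply/seteqP; split=> _ [v hv <-].
    exists v.2 => //; rewrite [RHS]Df_expand hv scale0r add0r //.
  by exists (v *: (0, 1)); rewrite /vertical/= ?Df_scale// /GRing.scale/= mulr0.
rewrite jacobiE; move: (V _ _) => [p q] /=; split.
  (* The point of abscissa 1 on the graph is a multiple of [(p, q)]: this forces [p != 0] and gives
     the slope. *)
  move=> e; have : [set (d, s * d) | d in [set: R]] (1, s * 1) by exists 1.
  rewrite -e mulr1 => -[t _ [tp tq]].
  have p0 : p != 0.
    by apply: contra_eqN tp => /eqP ->; rewrite /GRing.scale/= mulr0 eq_sym oner_eq0.
  split=> //; apply: (mulIf p0); rewrite divfK// -tq.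
  have -> : t *: q * p = q * (t * p) by rewrite /GRing.scale/=; ring.
  by rewrite (tp : t * p = 1) mulr1.
case=> p0 ->; apply/seteqP; split=> _ [t _ <-].
  by exists (t * p) => //; congr (_, _); rewrite /= /GRing.scale/= mulrCA divfK.
exists (t / p) => //; congr (_, _); rewrite /GRing.scale/= ?divfK//; ring.
Qed.

(* By [wedge_vertical], s_l - s_k is b (m - k) (m - l) divided by
   b (m - k) m * b (m - l) m. *)
Lemma slope_ltP m k l : slope_lt f (iterz f m x) k l <->
  0 < b (m - k) (m - l) * b (m - k) m * b (m - l) m.
Proof.
have key : b (m - k) m != 0 -> b (m - l) m != 0 ->
    ((V (m - k) m).2 / b (m - k) m < (V (m - l) m).2 / b (m - l) m) =
    (0 < b (m - k) (m - l) * b (m - k) m * b (m - l) m).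
  move=> p0 q0; rewrite -(wedge_vertical (m - k) (m - l) m) /wedge.
  move: p0 q0; rewrite !jacobiE; move: (V (m - k) m) (V (m - l) m) => [p r] [q s] /= p0 q0.
  have e : (p * s - r * q) * p * q = (s / q - r / p) * (p * q) ^+ 2.
    by field; rewrite p0 q0.
  by rewrite e pmulr_lgt0 ?subr_gt0// exprn_even_gt0//= mulf_neq0.
split.
  by case=> s [t] [/is_slopeP[p0 ->] /is_slopeP[q0 ->]]; rewrite key.
move=> h; have p0 : b (m - k) m != 0 by apply: contraTneq h => ->; rewrite mulr0 mul0r ltxx.
have q0 : b (m - l) m != 0 by apply: contraTneq h => ->; rewrite mulr0 ltxx.
exists ((V (m - k) m).2 / b (m - k) m), ((V (m - l) m).2 / b (m - l) m).
by split; [exact/is_slopeP|exact/is_slopeP|rewrite key].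
Qed.

Definition no_conjugate_points : Prop := forall i j : int, i < j -> 0 < b i j.

Lemma no_conjugate_nat :
  (forall m (n : nat), 0 < b m (m + n.+1%:Z)) -> no_conjugate_points.
Proof.
move=> h i j ij.
have [n nE] : exists n : nat, j - i = n.+1%:Z.
  by move: ij; rewrite -subr_gt0; case: (j - i) => // -[|n] // _; exists n.
by have := h i n; rewrite -nE addrC subrK.
Qed.

(** Induction on the distance with the left end fixed: the twist gives the first sign and each
    product passes it one step to the right. *)
Lemma no_conjugate_fwd :
  (forall m (n : nat), (1 <= n)%N -> 0 < b m (m + n%:Z) * b m (m + n.+1%:Z)) ->
  no_conjugate_points.
Proof.
move=> h; apply: no_conjugate_nat => m; elim=> [|n IHn]; first exact: jacobi_succ_gt0.
by have := h m n.+1 isT; rewrite (pmulr_rgt0 _ IHn).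
Qed.

(** Here the left end moves instead, so the induction hypothesis is used at [m + 1]. *)
Lemma no_conjugate_bwd :
  (forall m (n : nat), (1 <= n)%N -> 0 < b m (m + n%:Z) * b (m - 1) (m + n%:Z)) ->
  no_conjugate_points.
Proof.
move=> h; apply: no_conjugate_nat => m n; elim: n m => [|n IHn] m.
  exact: jacobi_succ_gt0.
have := h (m + 1) n.+1 isT; rewrite (pmulr_rgt0 _ (IHn (m + 1))).
by rewrite addrK -addrA -PoszD add1n.
Qed.

(** Up to the positive factor [b (m + n) (m + n + 1)], s_(-n) < s_(-n-1) at the m-th point says that
    [b m (m + n)] and [b m (m + n + 1)] have the same sign. *)
Lemma green_no_conjugate : green_set f x -> no_conjugate_points.
Proof.
move=> h; apply: no_conjugate_fwd => m n n1.
have [|/slope_ltP + _ _] := h (iterz f m x) _ n n1; first by exists m.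
have bn : 0 < b (m + n%:Z) (m + n.+1%:Z).
  by rewrite -[n.+1]addn1 PoszD addrA; exact: jacobi_succ_gt0.
rewrite !opprK (jacobiC m (m + n%:Z)) (jacobiC m (m + n.+1%:Z)).
move: (b _ _) (b _ _) (b _ _) bn => p q r p0.
by rewrite !(mulrN, mulNr) opprK -mulrA (pmulr_rgt0 _ p0).
Qed.

(** The same pair of values of [b] is compared by s_(-1) < s_n taken at the point of index
    [m + n]. *)
Lemma slope_lt_m1_no_conjugate :
  (forall y, orbit_of f x y -> forall k : nat, (1 <= k)%N -> slope_lt f y (- 1) k%:Z) ->
  no_conjugate_points.
Proof.
move=> h; apply: no_conjugate_fwd => m n n1.
have /slope_ltP := h (iterz f (m + n%:Z) x) (ex_intro2 _ _ _ I erefl) n n1.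
rewrite opprK addrK -addrA -PoszD addn1.
have : 0 < b (m + n%:Z) (m + n.+1%:Z).
  by rewrite -[n.+1]addn1 PoszD addrA; exact: jacobi_succ_gt0.
rewrite (jacobiC m (m + n.+1%:Z)) (jacobiC (m + n%:Z) (m + n.+1%:Z)).
move: (b _ _) (b _ _) (b _ _) => p q r p0.
by rewrite mulrNN mulrAC (pmulr_lgt0 _ p0) mulrC.
Qed.

(** At the m-th point, s_(-n) < s_1 compares [b (m - 1) (m + n)] with [b m (m + n)], hence the
    backward induction. *)
Lemma slope_lt_p1_no_conjugate :
  (forall y, orbit_of f x y -> forall k : nat, (1 <= k)%N -> slope_lt f y (- k%:Z) 1) ->
  no_conjugate_points.
Proof.
move=> h; apply: no_conjugate_bwd => m n n1.
have /slope_ltP := h (iterz f m x) (ex_intro2 _ _ _ I erefl) n n1.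
rewrite opprK (jacobiC (m - 1) (m + n%:Z)) (jacobiC m (m + n%:Z)).
have := jacobi_succ_gt0 (m - 1); rewrite subrK.
move: (b (m - 1) m) (b (m - 1) _) (b _ _) => p q r p0.
by rewrite mulrNN (pmulr_lgt0 _ p0) mulrC.
Qed.

Hypothesis pos : no_conjugate_points.

Lemma no_conjugate_lt0 i j : i < j -> b j i < 0.
Proof. by move=> ij; rewrite jacobiC oppr_lt0; exact: pos. Qed.

Lemma no_conjugate_slope_np m k l : k < 0 -> 0 < l -> slope_lt f (iterz f m x) k l.
Proof.
move=> k0 l0; apply/slope_ltP; rewrite -mulrA nmulr_rgt0.
  by rewrite nmulr_rlt0; [apply: pos|apply: no_conjugate_lt0]; lia.
by apply: no_conjugate_lt0; lia.
Qed.

Lemma no_conjugate_slope_nn m k l : l < k -> k < 0 -> slope_lt f (iterz f m x) k l.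
Proof.
move=> lk k0; apply/slope_ltP; rewrite -mulrA pmulr_rgt0; last by apply: pos; lia.
by rewrite nmulr_rgt0; apply: no_conjugate_lt0; lia.
Qed.

Lemma no_conjugate_slope_pp m k l : l < k -> 0 < l -> slope_lt f (iterz f m x) k l.
Proof.
move=> lk l0; apply/slope_ltP; rewrite -mulrA !pmulr_rgt0; apply: pos; lia.
Qed.

Lemma no_conjugate_green : green_set f x.
Proof.
move=> _ [m _ <-] n n1; split.
- by apply: no_conjugate_slope_nn; lia.
- by apply: no_conjugate_slope_np; lia.
- by apply: no_conjugate_slope_pp; lia.
Qed.

End Cocycle.

(** * Invariant half-lines and the limit Green slope *)

Section HalfLines.
Variable R : realType.
Local Notation A := (annulus R).
Local Notation R2 := (R * R)%type.
Variable f : C1_diffeo R.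
Hypothesis det1 : forall y, wedge (Df f y (1, 0)) (Df f y (0, 1)) = 1.
Hypothesis twist : forall y, 0 < (Df f y (0, 1)).1.
Variable x : A.
Local Notation V := (transported_vertical f x).

Lemma pair_scaleE (t : R) (u : R2) : t *: u = (t * u.1, t * u.2).
Proof. by []. Qed.

Lemma transported_vertical_succ i j : V i (j + 1) = Df f (iterz f j x) (V i j).
Proof. by rewrite -(transport_vertical f x i j (j + 1)) addrAC subrr add0r. Qed.

Lemma half_line_dir (D : set R2) : half_line D -> fst @` D = [set t : R | 0 <= t] ->
  exists2 v : R2, 0 < v.1 & D = [set t *: v | t in [set t : R | 0 <= t]].
Proof.
case=> v _ -> h; exists v => //.
have : [set t : R | 0 <= t] 1 by exact: ler01.
rewrite -h => -[_ [t t0 <-]] /= tv; rewrite ltNge; apply/negP => v0.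
by have := mulr_ge0_le0 t0 v0; rewrite [t * _]tv ler10.
Qed.

(** The vertical starts on the left of the half-line. The map preserves this side, and the twist
    keeps the image pointing to the right. *)
Lemma half_line_no_conjugate (delta : A -> set R2) :
  invariant_half_line_field f x delta -> no_conjugate_points f x.
Proof.
move=> hd.
have orb m : orbit_of f x (iterz f m x) by exists m.
have /choice[v hv] m : exists v : R2, 0 < v.1 /\
    delta (iterz f m x) = [set t *: v | t in [set t : R | 0 <= t]].
  by have [/half_line_dir h _ /h[v]] := hd _ (orb m); exists v.
have inv m : exists2 h : R, 0 <= h & Df f (iterz f m x) (v m) = h *: v (m + 1).
  have [_ e _] := hd _ (orb m).
  have : (Df f (iterz f m x) @` delta (iterz f m x)) (Df f (iterz f m x) (v m)).
    by exists (v m) => //; rewrite (hv m).2; exists 1; rewrite /= ?scale1r.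
  by rewrite e -iterzS (hv _).2 => -[h h0 <-]; exists h.
have step m w : 0 <= w.1 -> 0 < wedge (v m) w ->
    0 < (Df f (iterz f m x) w).1 /\ 0 < wedge (v (m + 1)) (Df f (iterz f m x) w).
  move=> w0 vw; have [h h0 hE] := inv m.
  have e1 : h * wedge (v (m + 1)) (Df f (iterz f m x) w) = wedge (v m) w.
    by rewrite -(wedge_Df det1 (iterz f m x) (v m) w) hE pair_scaleE /wedge /=; ring.
  (* If [h] vanished, the preserved wedge would vanish too. *)
  have hp : 0 < h.
    by rewrite lt_neqAle h0 andbT; apply: contraTneq vw => h0'; rewrite -e1 -h0' mul0r ltxx.
  split; last by rewrite -(pmulr_rgt0 _ hp) e1.
  (* First coordinate of the image under [Df] of the identity v.1 w = w.1 v + wedge(v, w) (0, 1),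
     where v is [v m]. *)
  have e2 : (v m).1 * (Df f (iterz f m x) w).1 =
      h * (v (m + 1)).1 * w.1 + (Df f (iterz f m x) (0, 1)).1 * wedge (v m) w.
    rewrite -[h * _]/((h *: v (m + 1)).1) -hE.
    rewrite [Df f _ w]Df_expand [Df f _ (v m)]Df_expand /wedge.
    by move: (Df f _ (1, 0)) (Df f _ (0, 1)) => [a c] [b d]; rewrite !pair_scaleE /=; ring.
  rewrite -(pmulr_rgt0 _ (hv m).1) e2 ltr_wpDl//; last by rewrite mulr_gt0.
  by rewrite !mulr_ge0// ltW// (hv _).1.
apply: no_conjugate_nat => m n.
suff : 0 < (V m (m + n.+1%:Z)).1 /\ 0 < wedge (v (m + n.+1%:Z)) (V m (m + n.+1%:Z)).
  by rewrite jacobiE => -[].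
elim: n => [|n [IH1 IH2]].
  rewrite transported_vertical_succ; apply: step; rewrite transported_verticalxx//.
  by rewrite /wedge /= mulr1 mulr0 subr0 (hv m).1.
rewrite -[n.+2]addn1 PoszD addrA transported_vertical_succ.
by apply: step => //; exact: ltW.
Qed.

Hypothesis pos : no_conjugate_points f x.

(* The slope s_(n+1)(y); 0 when G_(n+1)(y) is vertical, as u.2 / 0 = 0. *)
Definition green_slope_seq (y : A) (n : nat) : R :=
  let u := Df (iterz f n.+1) (iterz f (- n.+1%:Z) y) (0, 1) in u.2 / u.1.

(** Without conjugate points, on the orbit this is the slope of the upper Green bundle, the limit of
    the decreasing s_n. *)
Definition green_slope (y : A) : R := lim (green_slope_seq y @ \oo).

Lemma green_slope_seqE m n :
  green_slope_seq (iterz f m x) n = (V (m - n.+1%:Z) m).2 / jacobi f x (m - n.+1%:Z) m.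
Proof.
rewrite jacobiE /green_slope_seq -iterzD /transported_vertical (addrC _ m).
by have -> : m - (m - n.+1%:Z) = n.+1%:Z by lia.
Qed.

Lemma is_slope_green_seq m n :
  is_slope f n.+1 (iterz f m x) (green_slope_seq (iterz f m x) n).
Proof.
apply/is_slopeP; rewrite green_slope_seqE; split=> //.
by apply: lt0r_neq0; apply: pos; lia.
Qed.

Lemma is_slope_uniq k y s t : is_slope f k y s -> is_slope f k y t -> s = t.
Proof.
rewrite /is_slope => -> e.
have : [set (d, s * d) | d in [set: R]] (1, s) by exists 1; rewrite ?mulr1.
by rewrite e => -[d _ [-> <-]]; rewrite mulr1.
Qed.

Lemma green_slope_seq_decr m : nonincreasing_seq (green_slope_seq (iterz f m x)).
Proof.
apply/nonincreasing_seqP => n.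
have [||s [t [sE tE st]]] := @no_conjugate_slope_pp _ f det1 x pos m n.+2 n.+1; [by lia..|].
rewrite (is_slope_uniq (is_slope_green_seq m _) sE).
by rewrite (is_slope_uniq (is_slope_green_seq m _) tE) ltW.
Qed.

Lemma green_slope_seq_gt m n k s : k < 0 -> is_slope f k (iterz f m x) s ->
  s < green_slope_seq (iterz f m x) n.
Proof.
move=> k0 hs.
have [||s' [t [sE tE st]]] := @no_conjugate_slope_np _ f det1 x pos m k n.+1; [by lia..|].
by rewrite (is_slope_uniq (is_slope_green_seq m _) tE) (is_slope_uniq hs sE).
Qed.

Lemma green_slope_cvg m :
  green_slope_seq (iterz f m x) @ \oo --> green_slope (iterz f m x).
Proof.
have [||s [_ [sE _ _]]] := @no_conjugate_slope_np _ f det1 x pos m (-1) 1; [by lia..|].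
apply: nonincreasing_is_cvgn; first exact: green_slope_seq_decr.
by exists s => _ [n _ <-]; rewrite ltW// (green_slope_seq_gt _ _ sE).
Qed.

(** Limits keep only weak inequalities; strictness comes from inserting s_(-2), which exceeds s_(-1)
    and lies below every s_n. *)
Lemma green_slope_gt m s : is_slope f (-1) (iterz f m x) s ->
  s < green_slope (iterz f m x).
Proof.
move=> hs.
have [||s' [t [sE tE st]]] := @no_conjugate_slope_nn _ f det1 x pos m (-1) (-2); [by lia..|].
rewrite (is_slope_uniq hs sE) (lt_le_trans st)//.
apply: limr_ge; first by apply/cvg_ex; eexists; exact: green_slope_cvg.
by apply: nearW => n; rewrite ltW// (green_slope_seq_gt _ _ tE).
Qed.

Lemma Df_graph y (s : R) : Df f y (1, s) =
  ((Df f y (1, 0)).1 + s * (Df f y (0, 1)).1, (Df f y (1, 0)).2 + s * (Df f y (0, 1)).2).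
Proof. by rewrite Df_expand /= scale1r. Qed.

(** [Df] sends G_(n+1) at [y] to G_(n+2) at [f y]. The relation is written without quotients so that
    it passes to the limit. *)
Lemma green_slope_seq_step m n :
  let y := iterz f m x in
  (Df f y (1, green_slope_seq y n)).2 =
  green_slope_seq (f y) n.+1 * (Df f y (1, green_slope_seq y n)).1.
Proof.
move=> y; rewrite -iterzS !green_slope_seqE.
have -> : m + 1 - n.+2%:Z = m - n.+1%:Z by lia.
have p0 : jacobi f x (m - n.+1%:Z) (m + 1) != 0 by apply: lt0r_neq0; apply: pos; lia.
have q0 : jacobi f x (m - n.+1%:Z) m != 0 by apply: lt0r_neq0; apply: pos; lia.
have -> : (1, (V (m - n.+1%:Z) m).2 / jacobi f x (m - n.+1%:Z) m) =
    (jacobi f x (m - n.+1%:Z) m)^-1 *: V (m - n.+1%:Z) m.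
  by rewrite jacobiE in q0 *; rewrite pair_scaleE mulVf// mulrC.
rewrite Df_scale -transported_vertical_succ jacobiE in p0 *.
by rewrite pair_scaleE /= mulrCA divfK.
Qed.

(** By the twist, the first coordinate of [Df (1, s)] is affine and increasing in [s]. It vanishes
    at s_(-1), whose line is mapped to the vertical, and the limit slope is larger. *)
Lemma green_slope_dir m : 0 < (Df f (iterz f m x) (1, green_slope (iterz f m x))).1.
Proof.
have [||s [_ [sE _ _]]] := @no_conjugate_slope_np _ f det1 x pos m (-1) 1; [by lia..|].
have gs := green_slope_gt sE.
have [q0 sE'] := (is_slopeP f x _ _ _).1 sE; rewrite opprK in q0 sE'.
have : Df f (iterz f m x) (V (m + 1) m) = (0, 1).
  by rewrite -transported_vertical_succ transported_verticalxx.
have -> : V (m + 1) m = jacobi f x (m + 1) m *: (1, s).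
  rewrite sE' !jacobiE; rewrite jacobiE in q0.
  by rewrite pair_scaleE /= mulr1 mulrC divfK// -surjective_pairing.
rewrite Df_scale (Df_graph _ s) (Df_graph _ (green_slope _)) => /(congr1 fst) /= e.
have {}e : (Df f (iterz f m x) (1, 0)).1 + s * (Df f (iterz f m x) (0, 1)).1 = 0.
  by apply: (mulfI q0); rewrite mulr0 -[RHS]e.
by rewrite -[ltLHS]e ltrD2l ltr_pM2r.
Qed.

Lemma green_slope_step m : let y := iterz f m x in
  (Df f y (1, green_slope y)).2 = green_slope (f y) * (Df f y (1, green_slope y)).1.
Proof.
move=> y; rewrite (Df_graph _ (green_slope y)) /=; set p := Df f y (1, 0); set q := Df f y (0, 1).
have cy : green_slope_seq y n @[n --> \oo] --> green_slope y := @green_slope_cvg m.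
have cfy : green_slope_seq (f y) n.+1 @[n --> \oo] --> green_slope (f y).
  have := @green_slope_cvg (m + 1); rewrite iterzS => h.
  by rewrite -cvg_shiftS in h.
have c1 (u : R2) : u.1 + green_slope_seq y n * u.2 @[n --> \oo] --> u.1 + green_slope y * u.2.
  exact: (cvgD (cvg_cst _) (cvgM cy (cvg_cst _))).
have cl := c1 (p.2, q.2); have cr := cvgM cfy (c1 (p.1, q.1)).
rewrite (_ : _ \* _ = (fun n => p.2 + green_slope_seq y n * q.2)) in cr.
  exact: (cvg_unique _ cl (cr _)).
apply/funext => n /=; have := green_slope_seq_step m n.
by rewrite /= (Df_graph _ (green_slope_seq _ _)).
Qed.

Lemma no_conjugate_half_line :
  exists delta : A -> set R2, invariant_half_line_field f x delta.
Proof.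
exists (fun y => [set t *: (1, green_slope y) | t in [set t : R | 0 <= t]]).
move=> _ [m _ <-]; split.
- exists (1, green_slope (iterz f m x)) => //.
  by apply: contraTneq (oner_neq0 R) => -[/eqP ->].
- set y := iterz f m x.
  have a0 := green_slope_dir m; set a := (Df _ _ _).1 in a0.
  have E : Df f y (1, green_slope y) = a *: (1, green_slope (f y)).
    by rewrite [LHS]surjective_pairing (green_slope_step m) pair_scaleE /= mulr1 mulrC.
  clearbody a; apply/seteqP; split=> [_ [_ [t t0 <-] <-]|_ [t t0 <-]].
    exists (t * a); first by rewrite /= mulr_ge0// ltW.
    by rewrite Df_scale E scalerA.
  exists ((t / a) *: (1, green_slope y)).
    exists (t / a); last exact: erefl.
    exact: (divr_ge0 t0 (ltW a0)).
  by rewrite Df_scale E scalerA divfK// gt_eqF.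
- apply/seteqP; split=> [_ [_ [t t0 <-] <-]|t t0]; first by rewrite pair_scaleE /= mulr1.
  by exists (t *: (1, green_slope (iterz f m x))); [exists t|rewrite pair_scaleE /= mulr1].
Qed.

End HalfLines.

(** * Tridiagonal quadratic forms and their pivots *)

Section Riccati.
Variable R : realType.
Implicit Types P B Q xi : nat -> R.

(** The contribution of one edge to the second variation: [P], [B], [Q] stand for the second
    derivatives d11 S, - d12 S, d22 S on that edge. *)
Definition jacobi_term P B Q xi (i : nat) : R :=
  P i * xi i ^+ 2 - 2 * B i * xi i * xi i.+1 + Q i * xi i.+1 ^+ 2.

(* For the Hessians of S along an orbit, [riccati P B Q m] is the slope s_(m+1)
   at the (m+1)-th point, and [pivot P B Q m] is s_(m+1) - s_(-1) there, which is
   also a pivot of Gaussian elimination on the tridiagonal second variation. *)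
Fixpoint riccati P B Q (m : nat) : R :=
  if m is m'.+1 then Q m - B m ^+ 2 / (riccati P B Q m' + P m) else Q 0%N.

Definition pivot P B Q m : R := riccati P B Q m + P m.+1.

(** Needed because a finite segment shares its coefficients with the orbit only up to its length. *)
Lemma eq_pivot P B Q P' B' Q' n :
  (forall i, (i <= n.+1)%N -> [/\ P i = P' i, B i = B' i & Q i = Q' i]) ->
  pivot P B Q n = pivot P' B' Q' n.
Proof.
move=> h; rewrite /pivot; congr (_ + _); last by have [] := h n.+1 (leqnn _).
elim: n h => [|n IHn] h /=; first by have [] := h 0%N isT.
have [-> -> ->] := h n.+1 (leqnSn _); rewrite IHn// => i /leqW; exact: h.
Qed.

Lemma riccati_le P B Q xi n : (forall m, (m < n)%N -> 0 < pivot P B Q m) ->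
  xi 0%N = 0 ->
  riccati P B Q n * xi n.+1 ^+ 2 <= \sum_(i < n.+1) jacobi_term P B Q xi i.
Proof.
move=> + xi0; elim: n => [_|n IHn hp].
  by rewrite big_ord1 /jacobi_term xi0 /= !expr2 !(mulr0, mul0r) subrr add0r.
rewrite big_ord_recr /= -/(pivot P B Q n).
have {}IHn := IHn (fun m mn => hp m (ltnW mn)).
have p0 := hp n (ltnSn n); apply: le_trans (lerD IHn (lexx _)).
rewrite -subr_ge0 /jacobi_term.
(* Completing the square in [xi n.+1], one step of Gaussian elimination. *)
rewrite (_ : _ - _ = (pivot P B Q n)^-1 *
    (pivot P B Q n * xi n.+1 - B n.+1 * xi n.+2) ^+ 2).
  by rewrite mulr_ge0 ?sqr_ge0// invr_ge0 ltW.
rewrite (_ : riccati P B Q n = pivot P B Q n - P n.+1); last by rewrite /pivot addrK.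
by field; rewrite gt_eqF.
Qed.

(** The equality case of [riccati_le]: the earlier vector is rescaled by [t] so that the new square
    vanishes. *)
Lemma riccati_attained P B Q n : (forall m, (m < n)%N -> 0 < pivot P B Q m) ->
  exists xi, [/\ xi 0%N = 0, xi n.+1 = 1 &
    \sum_(i < n.+1) jacobi_term P B Q xi i = riccati P B Q n].
Proof.
elim: n => [_|n IHn hp].
  exists (fun i => (i != 0%N)%:R); split=> //.
  by rewrite big_ord1 /jacobi_term /= !expr2 !(mulr0, mul0r, mulr1) subrr add0r.
have [xi [xi0 xi1 xiE]] := IHn (fun m mn => hp m (ltnW mn)).
have p0 := hp n (ltnSn n); pose t := B n.+1 / pivot P B Q n.
exists (fun i => if (i <= n.+1)%N then t * xi i else 1); split=> //=.
- by rewrite xi0 mulr0.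
- by rewrite ltnn.
rewrite big_ord_recr /= (eq_bigr (fun i : 'I_n.+1 => t ^+ 2 * jacobi_term P B Q xi i)).
  rewrite -mulr_sumr xiE /jacobi_term leqnn ltnn xi1 /t -/(pivot P B Q n).
  rewrite (_ : riccati P B Q n = pivot P B Q n - P n.+1); last by rewrite /pivot addrK.
  by field; rewrite gt_eqF.
by move=> i _; rewrite /jacobi_term !ltnS (ltnW (ltn_ord i)) leq_ord; ring.
Qed.

(** Extending the extremal vector by 0 makes the form equal to the pivot, possibly 0. One more
    vertex of small height [t > 0] adds [t * (t * K - 2 * B n.+1)], which is negative. *)
Lemma riccati_negative P B Q n : (forall m, (m < n)%N -> 0 < pivot P B Q m) ->
  pivot P B Q n <= 0 -> 0 < B n.+1 ->
  exists xi, [/\ xi 0%N = 0, xi n.+3 = 0 &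
    \sum_(i < n.+3) jacobi_term P B Q xi i < 0].
Proof.
move=> hp pn B0; have [xi [xi0 xi1 xiE]] := riccati_attained hp.
(* This [t] ensures [t * K < B n.+1], whatever the sign of [K]. *)
pose K := Q n.+1 + P n.+2; pose t := B n.+1 / (1 + `|K|).
have K1 : 0 < 1 + `|K| by rewrite ltr_pwDl.
have t0 : 0 < t by rewrite divr_gt0.
exists (fun i => if (i <= n.+1)%N then xi i else if (i == n.+2)%N then t else 0).
split=> //=; first by rewrite ltnNge leqnSn /= -[(n.+3 == n.+2)%N]/(n.+1 == n)%N gtn_eqF.
rewrite 2!big_ord_recr /= (eq_bigr (fun i : 'I_n.+1 => jacobi_term P B Q xi i)); last first.
  by move=> i _; rewrite /jacobi_term !ltnS (ltnW (ltn_ord i)) leq_ord.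
rewrite xiE /jacobi_term leqnn ltnn eqxx xi1 !ltnNge leqnSn /=.
rewrite (_ : (n.+3 == n.+2)%N = false) ?gtn_eqF//.
have tK : t * K < B n.+1.
  rewrite (le_lt_trans (ler_norm _))// normrM gtr0_norm// /t.
  rewrite mulrAC -mulrA gtr_pMr// ltr_pdivrMr// mul1r ltrDr//.
have -> : riccati P B Q n = pivot P B Q n - P n.+1 by rewrite /pivot addrK.
have : t * (t * K - 2 * B n.+1) < 0 by rewrite nmulr_llt0// subr_lt0; lra.
rewrite /K; nra.
Qed.

(** The induction also carries continuity of [riccati] at [a]: its recursion divides by the previous
    pivot, which is nonzero there. *)
Lemma near_pivot_gt0 (T : topologicalType) (a : T) (P B Q : T -> nat -> R) n :
  (forall i, {for a, continuous (P^~ i)}) ->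
  (forall i, {for a, continuous (B^~ i)}) ->
  (forall i, {for a, continuous (Q^~ i)}) ->
  (forall m, (m < n)%N -> 0 < pivot (P a) (B a) (Q a) m) ->
  \forall c \near a, forall m, (m < n)%N -> 0 < pivot (P c) (B c) (Q c) m.
Proof.
move=> cP cB cQ; suff cr : (forall m, (m < n)%N -> 0 < pivot (P a) (B a) (Q a) m) ->
    {for a, continuous (fun c => riccati (P c) (B c) (Q c) n)} /\
    \forall c \near a, forall m, (m < n)%N -> 0 < pivot (P c) (B c) (Q c) m.
  by move/cr => [].
elim: n => [|n IHn] hp.
  by split; [exact: cQ|apply: nearW].
have [c1 c2] := IHn (fun m mn => hp m (ltnW mn)).
have cp : {for a, continuous (fun c => pivot (P c) (B c) (Q c) n)}.
  by apply: continuousD; [exact: c1|exact: cP].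
have p0 := hp n (ltnSn n); split.
  apply: continuousB; first exact: cQ.
  apply: continuousM; first by apply: continuousM; exact: cB.
  by apply: continuousV => //; exact: lt0r_neq0.
have c3 : \forall c \near a, 0 < pivot (P c) (B c) (Q c) n by exact: cvgr_gt cp _ p0.
apply: filterS2 c2 c3 => c h1 h2 m; rewrite ltnS leq_eqVlt => /orP[/eqP -> //|].
exact: h1.
Qed.

(** The slope [r / u] of a solution of the linear system started at the vertical [(0, 1)] obeys the
    Riccati recursion. *)
Lemma riccati_solution P B Q (u r : nat -> R) n : (forall i, 0 < B i) ->
  u 0%N = 0 -> r 0%N = 1 ->
  (forall i, B i * u i.+1 = r i + P i * u i) ->
  (forall i, r i.+1 = - B i * u i + Q i * u i.+1) ->
  (forall m, (m < n)%N -> 0 < pivot P B Q m) ->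
  0 < u n.+1 /\ B n.+1 * u n.+2 = pivot P B Q n * u n.+1.
Proof.
move=> B0 u0 r0 hu hr hp.
suff [p0 e] : 0 < u n.+1 /\ r n.+1 = riccati P B Q n * u n.+1.
  by split=> //; rewrite hu e /pivot mulrDl.
elim: n hp => [_|n IHn hp].
  have e1 := hu 0%N; rewrite u0 r0 mulr0 addr0 in e1; split.
    by rewrite -(pmulr_rgt0 _ (B0 0%N)) e1.
  by rewrite hr u0 mulr0 add0r.
have [p0 e] := IHn (fun j jn => hp j (ltnW jn)).
have pn := hp n (ltnSn n).
have e1 : B n.+1 * u n.+2 = pivot P B Q n * u n.+1 by rewrite hu e /pivot mulrDl.
split; first by rewrite -(pmulr_rgt0 _ (B0 n.+1)) e1 mulr_gt0.
rewrite hr /= -/(pivot P B Q n).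
have -> : u n.+1 = B n.+1 * u n.+2 / pivot P B Q n.
  by rewrite e1 mulrC mulKf// gt_eqF.
by field; rewrite gt_eqF.
Qed.

Lemma pivots_gt0P P B Q (u r : nat -> R) : (forall i, 0 < B i) ->
  u 0%N = 0 -> r 0%N = 1 ->
  (forall i, B i * u i.+1 = r i + P i * u i) ->
  (forall i, r i.+1 = - B i * u i + Q i * u i.+1) ->
  (forall n, 0 < u n.+1) <-> (forall n, 0 < pivot P B Q n).
Proof.
move=> B0 u0 r0 hu hr; split=> h n; last first.
  by have [] := riccati_solution B0 u0 r0 hu hr (fun m (_ : (m < n)%N) => h m).
elim/ltn_ind: n => n IHn.
have [p0 e] := riccati_solution B0 u0 r0 hu hr IHn.
by rewrite -(pmulr_lgt0 _ p0) -e mulr_gt0.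
Qed.

End Riccati.

(** * Second variation of the action along straight lines *)

Section SecondVariation.
Variable R : realType.
Local Notation R2 := (R * R)%type.
Variable S : R2 -> R.
Hypothesis C2S : C2_plane S.
Implicit Types (a xi : nat -> R) (w u : R2).

Definition edge (a : nat -> R) (i : nat) : R2 := (a i, a i.+1).

Definition hessian w u : R := u.1 ^+ 2 * d1 (d1 S) w +
  2 * u.1 * u.2 * d1 (d2 S) w + u.2 ^+ 2 * d2 (d2 S) w.

Lemma derive2_dirE w u : 'D_u ('D_u S) w = hessian w u.
Proof.
have e1 : d1 ('D_u S) w = u.1 * d1 (d1 S) w + u.2 * d1 (d2 S) w.
  apply: etrans (derive_comm w u (1, 0) C2S) _.
  rewrite (derive_dirE _ ((C2S.2 _).1 w)).
  exact: (congr1 (fun t => _ + _ * t) (derive_comm w (1, 0) (0, 1) C2S)).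
have e2 : d2 ('D_u S) w = u.1 * d1 (d2 S) w + u.2 * d2 (d2 S) w.
  apply: etrans (derive_comm w u (0, 1) C2S) _.
  exact: (derive_dirE _ ((C2S.2 _).1 w)).
rewrite (derive_dirE _ ((C2S.2 _).1 w)) e1 e2 /hessian.
by move: (d1 (d1 S) w) (d1 (d2 S) w) (d2 (d2 S) w) => p q r; ring.
Qed.

Lemma continuous_hessian u : continuous (hessian^~ u).
Proof.
rewrite (_ : hessian^~ u = 'D_u ('D_u S)); first exact: (C2S.2 u).2.
by apply/funext => w; rewrite derive2_dirE.
Qed.

(** The mean value theorem is applied to the action, then to its derivative, which vanishes at time
    0 by criticality. *)
Lemma second_variation n a xi (h : R) : 0 < h ->
  \sum_(i < n) 'D_(edge xi i) S (edge a i) = 0 ->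
  exists c d, [/\ 0 < c < h, 0 < d < c &
    \sum_(i < n) S (edge a i + h *: edge xi i) - \sum_(i < n) S (edge a i) =
    (\sum_(i < n) hessian (edge a i + d *: edge xi i) (edge xi i)) * c * h].
Proof.
move=> h0 crit.
have line (u : 'I_n -> R2 -> R) (t : R) : (forall i w, differentiable (u i) w) ->
    is_derive t (1 : R) (fun t => \sum_(i < n) u i (edge a i + t *: edge xi i))
    (\sum_(i < n) 'D_(edge xi i) (u i) (edge a i + t *: edge xi i)).
  move=> du.
  have := is_derive_sum (fun i => is_derive_line (du i (edge a i + t *: edge xi i))).
  congr (is_derive _ _ _ _); by rewrite fct_sumE.
have dS w : differentiable S w := C2S.1.1 w.
have [c hc] := MVT0 h0 (fun t => line (fun=> S) t (fun _ w => dS w)).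
have [c0 _] := andP hc.
have [d hd] := MVT0 c0 (fun t => line (fun i => 'D_(edge xi i) S) t
  (fun i w => (C2S.2 (edge xi i)).1 w)).
have e0 (u : 'I_n -> R2 -> R) :
    \sum_(i < n) u i (edge a i + 0 *: edge xi i) = \sum_(i < n) u i (edge a i).
  by apply: eq_bigr => i _; rewrite scale0r addr0.
rewrite (e0 (fun i => 'D_(edge xi i) S)) crit subr0 => e2; rewrite (e0 (fun=> S)) e2 => e1.
exists c, d; split; [exact: hc|exact: hd|].
apply: (etrans e1); congr (_ * _ * _).
by apply: eq_bigr => i _; rewrite derive2_dirE.
Qed.

(** A negative second variation stays negative for small times by continuity, and the action would
    then drop below its initial value. *)
Lemma second_variation_ge0 n a xi :
  \sum_(i < n) 'D_(edge xi i) S (edge a i) = 0 ->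
  (\forall t \near (0 : R)^'+, \sum_(i < n) S (edge a i) <=
     \sum_(i < n) S (edge a i + t *: edge xi i)) ->
  0 <= \sum_(i < n) hessian (edge a i) (edge xi i).
Proof.
move=> crit hmin; rewrite leNgt; apply/negP => hneg.
pose q (t : R) := \sum_(i < n) hessian (edge a i + t *: edge xi i) (edge xi i).
have cq : continuous q.
  have cl i : continuous (fun t : R => edge a i + t *: edge xi i).
    by move=> t; apply: cvgD; [exact: cvg_cst|apply: cvgZr_tmp; exact: cvg_id].
  rewrite /q; elim: (index_enum _) => [|i s IHs] t.
    rewrite (_ : (fun t => _) = cst 0); first exact: cst_continuous.
    by apply/funext => t'; rewrite big_nil.
  rewrite (_ : (fun t => _) = (fun t => hessian (edge a i + t *: edge xi i) (edge xi i)) +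
    (fun t => \sum_(j <- s) hessian (edge a j + t *: edge xi j) (edge xi j))).
    apply: cvgD; last exact: IHs.
    exact: (continuous_comp (cl i t) (@continuous_hessian (edge xi i) _)).
  by apply/funext => t'; rewrite big_cons.
have q0 : q 0 = \sum_(i < n) hessian (edge a i) (edge xi i).
  by apply: eq_bigr => i _; rewrite scale0r addr0.
have /nbhs_ballP[e /= e0 he] : \forall t \near (0 : R), q t < 0.
  have /cvgr_lt cq0 := cq 0; apply: cq0.
  by rewrite q0.
have [h [h0 [he' hh]]] := filter_ex (filterI (nbhs_right_gt (0 : R))
  (filterI (nbhs_right_lt e0) hmin)).
have [c [d [/andP[c0 ch] /andP[d0 dc] E]]] := second_variation h0 crit.
have : q d < 0.
  apply: he; rewrite /ball/= sub0r normrN (gtr0_norm d0).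
  exact: lt_trans dc (lt_trans ch he').
rewrite ltNge => /negP; apply.
move: hh; rewrite -subr_ge0 E -/(q d) => hh.
by rewrite -(pmulr_rge0 _ c0) -(pmulr_rge0 _ h0) mulrC [c * _]mulrC.
Qed.

End SecondVariation.

(** * Lifts of orbits; determinant and twist read off [S] *)

Section OrbitLifts.
Variable R : realType.
Local Notation A := (annulus R).
Local Notation R2 := (R * R)%type.
Variables (f : C1_diffeo R) (F : R2 -> R2) (S : R2 -> R).
Hypotheses (hF : is_lift F f) (hS : generating_function S F).

Lemma derive_periodic (v : R2) (a b : R) : 'D_v S (a + 1, b + 1) = 'D_v S (a, b).
Proof.
case: hS => _ per _ _.
have e (t : R) : S (t *: v + (a + 1, b + 1)) = S (t *: v + (a, b)).
  apply: etrans (per (t * v.1 + a) (t * v.2 + b)).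
  by congr (S (_, _)); exact: addrA.
have eS : S (a + 1, b + 1) = S (a, b) by exact: per.
rewrite /derive.
suff -> : (fun t : R =>
      t^-1 *: ((S \o shift (a + 1, b + 1)) (t *: v) - S (a + 1, b + 1))) =
    (fun t : R => t^-1 *: ((S \o shift (a, b)) (t *: v) - S (a, b))) by [].
by apply/funext => t; rewrite /= e eS.
Qed.

(** The generating equations determine [F] and are invariant under the diagonal translation of both
    angles. *)
Lemma lift_shift1 (z : R2) : F (z.1 + 1, z.2) = ((F z).1 + 1, (F z).2).
Proof.
have [e1 e2] := generating_lift hS z.
case: hS => _ _ _ h; apply/h; split.
  exact: (etrans e1 (esym (derive_periodic _ _ _))).
by rewrite {1}e2; congr (- _); exact: (esym (derive_periodic _ _ _)).
Qed.

Lemma lift_shift (z : R2) (m : int) : F (z.1 + m%:~R, z.2) = ((F z).1 + m%:~R, (F z).2).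
Proof.
elim/int_ind: m => [|n IHn|n IHn].
- by rewrite !addr0 -!surjective_pairing.
- by rewrite -[n.+1]addn1 PoszD intrD !addrA (lift_shift1 (_, _)) IHn.
- rewrite -[n.+1]addn1 PoszD opprD intrD !addrA.
  have := lift_shift1 (z.1 + (- n%:Z)%:~R - 1, z.2); rewrite /= subrK IHn.
  by case=> -> ->; rewrite addrK -surjective_pairing.
Qed.

Lemma lift_surj (w : R2) : exists z, F z = w.
Proof.
pose y := diffeo_inv f (covering w); pose z : R2 := (repr y.1, y.2).
have : covering w = covering (F z).
  by rewrite hF.2 covering_repr diffeo_invK.
case/covering_eq => -[m hm] h2; exists (z.1 + m%:~R, z.2).
by rewrite lift_shift -hm -h2 subrKC -surjective_pairing.
Qed.

(** The minimization assertion quantifies over lifts of the orbit, so one must exist for it to have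
    content. The backward half iterates a right inverse [G] of [F]. *)
Lemma orbit_lift_exists (x : A) : exists X : int -> R2, orbit_lift F f x X.
Proof.
have /choice[G FG] := lift_surj.
pose z0 : R2 := (repr x.1, x.2).
exists (fun k => match k with Posz n => iter n F z0 | Negz n => iter n.+1 G z0 end).
have covG w : covering (G w) = diffeo_inv f (covering w).
  by apply: (can_inj (diffeo_funK f)); rewrite diffeo_invK -hF.2 FG.
split=> [[n|[|n]]|[n|n]].
- by rewrite -PoszD addn1.
- by rewrite /= FG.
- by rewrite (_ : Negz n.+1 + 1 = Negz n) /= ?FG// !NegzE; ring.
- by elim: n => [|n IHn] /=; [exact: covering_repr|rewrite hF.2 IHn].
- elim: n => [|n IHn]; first by rewrite /= covG covering_repr.
  by rewrite [iter _ _ _]/= covG -[G _]/(iter n.+1 G z0) IHn.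
Qed.

(** Eliminating with [Df_generating], the determinant becomes [- (u * b)], where [u] is the twist
    entry and [b] the mixed derivative; the image of [(0, 1)] shows that this is 1. *)
Lemma Df_det1 y : wedge (Df f y (1, 0)) (Df f y (0, 1)) = 1.
Proof.
rewrite -(covering_repr y); set z := (repr y.1, y.2).
have [] := Df_generating hF hS z (1, 0); have [] := Df_generating hF hS z (0, 1).
have := cross_gt0 hS (z.1, (F z).1); rewrite /wedge.
move: (d1 (d2 S) _) (d1 (d1 S) _) (d2 (d2 S) _) => b p q.
move: (Df f _ (1, 0)) (Df f _ (0, 1)) => [a c] [u v] /= b0 e1 e2 e3 e4.
by rewrite e2 e4 [RHS]e1; ring.
Qed.

Lemma Df_twist y : 0 < (Df f y (0, 1)).1.
Proof.
rewrite -(covering_repr y); set z := (repr y.1, y.2).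
have [+ _] := Df_generating hF hS z (0, 1).
have := cross_gt0 hS (z.1, (F z).1).
move: (d1 (d2 S) _) (d1 (d1 S) _) => b p.
move: (Df f _ (0, 1)) => [u v] /= b0 e1.
rewrite -(pmulr_lgt0 _ b0); lra.
Qed.

End OrbitLifts.

(** * Local minimization and positivity of the pivots *)

Section Minimizing.
Variable R : realType.
Local Notation A := (annulus R).
Local Notation R2 := (R * R)%type.
Variables (f : C1_diffeo R) (F : R2 -> R2) (S : R2 -> R).
Hypotheses (hF : is_lift F f) (hS : generating_function S F).
Variables (x : A) (X : int -> R2).
Hypothesis hX : orbit_lift F f x X.

Local Notation C2S := (generating_C2 hS).

Definition angles (l : int) (i : nat) : R := (X (l + i%:Z)).1.

Definition hess11 (a : nat -> R) (i : nat) : R := d1 (d1 S) (edge a i).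
Definition hess12 (a : nat -> R) (i : nat) : R := - d1 (d2 S) (edge a i).
Definition hess22 (a : nat -> R) (i : nat) : R := d2 (d2 S) (edge a i).

Local Notation pivots a := (pivot (hess11 a) (hess12 a) (hess22 a)).

Lemma hessian_jacobi_term a xi i :
  hessian S (edge a i) (edge xi i) = jacobi_term (hess11 a) (hess12 a) (hess22 a) xi i.
Proof.
rewrite /hessian /jacobi_term /hess11 /hess12 /hess22 /=.
by move: (d1 (d1 S) _) (d1 (d2 S) _) (d2 (d2 S) _) => p b q; ring.
Qed.

Lemma angles_generating l i :
  (X (l + i.+1%:Z)).2 = d2 S (edge (angles l) i) /\
  (X (l + i%:Z)).2 = - d1 S (edge (angles l) i).
Proof.
have [e1 e2] := generating_lift hS (X (l + i%:Z)).
rewrite -hX.1 -addrA -PoszD addn1 in e1 e2.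
by split; [exact: e1|exact: e2].
Qed.

(** At an interior vertex, [d2 S] on the incoming edge and [- d1 S] on the outgoing one both equal
    the height of the orbit point, so the sum telescopes. *)
Lemma angles_critical l n xi :
  \sum_(i < n) 'D_(edge xi i) S (edge (angles l) i) =
  xi n * (X (l + n%:Z)).2 - xi 0%N * (X l).2.
Proof.
elim: n => [|n IHn]; first by rewrite big_ord0 addr0 subrr.
rewrite big_ord_recr /= IHn (derive_dirE _ (C2S.1.1 _)).
have [e1 e2] := angles_generating l n.
rewrite e1 [(X (l + n%:Z)).2]e2 /=.
by move: (d1 S _) (d2 S _) => p q; ring.
Qed.

Lemma transported_vertical_angles m n :
  let V k := transported_vertical f x m (m + k%:Z) in
  let a := angles m in
  hess12 a n * (V n.+1).1 = (V n).2 + hess11 a n * (V n).1 /\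
  (V n.+1).2 = - hess12 a n * (V n).1 + hess22 a n * (V n.+1).1.
Proof.
move=> V a.
have VS : V n.+1 = Df f (covering (X (m + n%:Z))) (V n).
  by rewrite hX.2 /V -[n.+1]addn1 PoszD addrA -transported_vertical_succ.
have [e1 e2] := Df_generating hF hS (X (m + n%:Z)) (V n).
rewrite -VS -hX.1 -addrA -PoszD addn1 -/(edge (angles m) n) in e1 e2.
rewrite /hess12 /hess11 /hess22 /a.
move: (d1 (d1 S) _) (d1 (d2 S) _) (d2 (d2 S) _) (V n.+1) (V n) e1 e2.
move=> p b q [v1 v2] [u1 u2] /= -> ->; split; ring.
Qed.

(** For each [m], the coordinates of the vertical transported from the m-th point solve the system
    of [pivots_gt0P]. *)
Lemma no_conjugate_pivots :
  no_conjugate_points f x <-> forall m n, 0 < pivots (angles m) n.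
Proof.
have B0 m i : 0 < hess12 (angles m) i := cross_gt0 hS _.
have key m : (forall n : nat, 0 < jacobi f x m (m + n.+1%:Z)) <->
    forall n, 0 < pivots (angles m) n.
  apply: (@pivots_gt0P _ _ _ _ (fun n => jacobi f x m (m + n%:Z))
    (fun n => (transported_vertical f x m (m + n%:Z)).2) (B0 m)).
  - by rewrite jacobiE addr0 transported_verticalxx.
  - by rewrite addr0 transported_verticalxx.
  - by move=> i; rewrite !jacobiE; exact: (transported_vertical_angles m i).1.
  - by move=> i; rewrite !jacobiE; exact: (transported_vertical_angles m i).2.
split=> h; first by move=> m; apply/key => n; apply: h; lia.
by apply: no_conjugate_nat => m; apply/key.
Qed.

(* The coordinates of a row vector; junk (the 0-th one) beyond its length. *)
Definition coords n (a : 'rV[R]_n.+1) (i : nat) : R := a 0 (inord i).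

Lemma action_coords n (a : 'rV[R]_n.+1) :
  action S a = \sum_(i < n) S (edge (coords a) i).
Proof.
apply: eq_bigr => i _; congr (S (a 0 _, a 0 _)); apply: val_inj => /=.
  by rewrite inordK// ltnW// ltnS.
by rewrite inordK// ltnS.
Qed.

Lemma coords_projected l n i : (i <= n)%N ->
  coords (projected_segment X l n) i = angles l i.
Proof. by move=> ni; rewrite /coords mxE inordK. Qed.

Lemma edge_projected l n i : (i < n)%N ->
  edge (coords (projected_segment X l n)) i = edge (angles l) i.
Proof.
by move=> ni; congr (_, _); apply: coords_projected; rewrite // ltnW.
Qed.

Lemma edge_line n (a b : 'rV[R]_n.+1) (t : R) i :
  edge (coords (a + t *: b)) i = edge (coords a) i + t *: edge (coords b) i.
Proof. by congr (_, _); rewrite /coords !mxE. Qed.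

Lemma locally_minimizing_hessian l n xi :
  locally_minimizing S (projected_segment X l n) -> xi 0%N = 0 -> xi n = 0 ->
  0 <= \sum_(i < n) hessian S (edge (angles l) i) (edge xi i).
Proof.
move=> hmin xi0 xin; set a := projected_segment X l n in hmin.
pose b : 'rV[R]_n.+1 := \row_(i < n.+1) xi i.
have cb i : (i <= n)%N -> coords b i = xi i by move=> ni; rewrite /coords mxE inordK.
apply: (second_variation_ge0 C2S).
  by rewrite angles_critical xi0 xin !mul0r subrr.
have cl : (fun t : R => a + t *: b) @ (0 : R) --> a.
  rewrite -[X in _ --> X]addr0 -(scale0r b).
  by apply: cvgD; [exact: cvg_cst|apply: cvgZr_tmp; exact: cvg_id].
have near0 : \forall t \near (0 : R),
    (a + t *: b) 0 ord0 = a 0 ord0 -> (a + t *: b) 0 ord_max = a 0 ord_max ->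
    action S a <= action S (a + t *: b) := cl _ hmin.
have ineq (t : R) : action S a <= action S (a + t *: b) ->
    \sum_(i < n) S (edge (angles l) i) <=
    \sum_(i < n) S (edge (angles l) i + t *: edge xi i).
  rewrite !action_coords => ht.
  have e1 (i : 'I_n) : edge (coords a) i = edge (angles l) i.
    exact/edge_projected/ltn_ord.
  have e2 (i : 'I_n) : edge (coords b) i = edge xi i.
    by congr (_, _); apply: cb; [apply/ltnW/ltn_ord|apply: ltn_ord].
  rewrite (eq_bigr (fun i : 'I_n => S (edge (coords a) i))); last first.
    by move=> i _; rewrite e1.
  apply: (le_trans ht); rewrite le_eqVlt; apply/orP; left; apply/eqP.
  by apply: eq_bigr => i _; rewrite edge_line e1 e2.
have near1 : \forall t \near (0 : R), \sum_(i < n) S (edge (angles l) i) <=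
    \sum_(i < n) S (edge (angles l) i + t *: edge xi i).
  apply: filterS near0 => t ht; apply/ineq/ht.
    by rewrite !mxE /= xi0 mulr0 addr0.
  by rewrite !mxE /= xin mulr0 addr0.
exact: (@cvg_within _ (nbhs (0 : R)) _ _ _ near1).
Qed.

Lemma locally_minimizing_no_conjugate :
  (forall l n, locally_minimizing S (projected_segment X l n)) ->
  no_conjugate_points f x.
Proof.
move=> hmin; apply/no_conjugate_pivots => m; elim/ltn_ind => n IHn.
rewrite ltNge; apply/negP => pn.
(* By strong induction this is the first nonpositive pivot; the segment with [n.+3] edges then has a
   descent direction fixing its ends. *)
have [xi [xi0 xin neg]] := riccati_negative IHn pn (cross_gt0 hS _).
have := locally_minimizing_hessian (hmin m n.+3) xi0 xin.
rewrite leNgt => /negP; apply.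
by under eq_bigr do rewrite hessian_jacobi_term.
Qed.

Lemma continuous_edge n (a : 'rV[R]_n.+1) i :
  {for a, continuous (fun c : 'rV[R]_n.+1 => edge (coords c) i)}.
Proof.
have h j : {for a, continuous (fun c : 'rV[R]_n.+1 => coords c j)}.
  exact: (@coord_continuous _ 1 n.+1 0 (inord j) a).
exact: (cvg_pair (h i) (h i.+1)).
Qed.

Lemma no_conjugate_locally_minimizing l n :
  no_conjugate_points f x -> locally_minimizing S (projected_segment X l n).
Proof.
move=> /no_conjugate_pivots /(_ l) hp; set a := projected_segment X l n.
(* A one-point segment has no edge, and its action is an empty sum. *)
case: n => [|n] in a *.
  by apply: (filterS _ filterT) => b _ _ _; rewrite !action_coords !big_ord0.
have ea i : (i <= n)%N -> edge (coords a) i = edge (angles l) i.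
  by move=> ni; apply: edge_projected.
clearbody a.
have ha m : (m < n)%N -> 0 < pivots (coords a) m.
  move=> mn; rewrite (@eq_pivot _ _ _ _ (hess11 (angles l))
    (hess12 (angles l)) (hess22 (angles l))).
    exact: hp.
  by move=> i im; rewrite /hess11 /hess12 /hess22 ea// (leq_trans im).
have cd (u : R2 -> R) i : continuous u ->
    {for a, continuous (fun c : 'rV[R]_n.+2 => u (edge (coords c) i))}.
  by move=> cu; exact: (cvg_comp _ _ (continuous_edge (i := i)) (cu _)).
have /nbhs_normP[e /= e0 he] : \forall c \near a,
    forall m, (m < n)%N -> 0 < pivots (coords c) m.
  apply: (@near_pivot_gt0 _ _ a (fun c => hess11 (coords c)) (fun c => hess12 (coords c))
    (fun c => hess22 (coords c))) => [i|i|i|]; last exact: ha.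
  - exact: cd ((C2S.2 _).2 _).
  - exact: cvgN (cd _ i ((C2S.2 _).2 _)).
  - exact: cd ((C2S.2 _).2 _).
have nb : nbhs a (ball_ Num.norm a e).
  by apply: (@nbhs_normP R 'rV[R]_n.+2 a _).2; exists e.
apply: (filterS _ nb) => b /= ab b0 bn; rewrite !action_coords.
pose xi := coords (b - a).
have i0 : inord 0 = ord0 :> 'I_n.+2 by apply: val_inj; rewrite /= inordK.
have im : inord n.+1 = ord_max :> 'I_n.+2 by apply: val_inj; rewrite /= inordK.
have xi0 : xi 0%N = 0 by rewrite /xi /coords i0 !mxE b0 subrr.
have xin : xi n.+1 = 0 by rewrite /xi /coords im !mxE bn subrr.
have crit : \sum_(i < n.+1) 'D_(edge xi i) S (edge (coords a) i) = 0.
  transitivity (\sum_(i < n.+1) 'D_(edge xi i) S (edge (angles l) i)).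
    by apply: eq_bigr => i _; rewrite ea// -ltnS ltn_ord.
  by rewrite angles_critical xi0 xin !mul0r subrr.
have [c [d [/andP[c0 c1] /andP[d0 dc] E]]] := second_variation C2S ltr01 crit.
have hb : \sum_(i < n.+1) S (edge (coords a) i + 1 *: edge xi i) =
    \sum_(i < n.+1) S (edge (coords b) i).
  by apply: eq_bigr => i _; rewrite /xi -edge_line scale1r subrKC.
rewrite -subr_ge0 -hb E mulr1 mulr_ge0 ?(ltW c0)//.
(* The intermediate segment lies between [a] and [b], hence in the ball where the pivots are
   positive. As [xi] vanishes at both ends, [riccati_le] bounds its second variation below by 0. *)
pose g := a + d *: (b - a).
have gP m : (m < n)%N -> 0 < pivots (coords g) m.
  apply: he; rewrite /= /g opprD addrA subrr add0r normrN normrZ gtr0_norm//.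
  rewrite distrC; apply: le_lt_trans ab.
  by rewrite ler_piMl// ltW// (lt_trans dc).
have := riccati_le gP xi0; rewrite xin expr2 !mulr0 => /le_trans; apply.
rewrite le_eqVlt; apply/orP; left; apply/eqP; apply: eq_bigr => i _.
by rewrite -hessian_jacobi_term /g edge_line.
Qed.

End Minimizing.

Theorem theorem7 (R : realType) (f : C1_diffeo R)
    (hf : conservative_twist_map f)
    (F : R * R -> R * R) (hF : is_lift F f)
    (S : R * R -> R) (hS : generating_function S F)
    (x : annulus R) :
  [<-> green_set f x;
       forall X : int -> R * R, orbit_lift F f x X ->
         forall (l : int) (n : nat),
           locally_minimizing S (projected_segment X l n);
       forall y, orbit_of f x y -> forall k : nat, (1 <= k)%N ->
         slope_lt f y (- 1) k%:Z;
       forall y, orbit_of f x y -> forall k : nat, (1 <= k)%N ->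
         slope_lt f y (- k%:Z) 1;
       exists delta : annulus R -> set (R * R),
         invariant_half_line_field f x delta].
Proof.
have det1 := Df_det1 hF hS; have twist := Df_twist hF hS.
tfae.
- move=> /(green_no_conjugate det1 twist) pos X hX l n.
  exact: (no_conjugate_locally_minimizing hF hS hX).
- have [X hX] := orbit_lift_exists hF hS x.
  move=> /(_ X hX) /(locally_minimizing_no_conjugate hF hS hX) pos _ [m _ <-] k k1.
  by apply: (no_conjugate_slope_np det1 pos); lia.
- move=> /(slope_lt_m1_no_conjugate det1 twist) pos _ [m _ <-] k k1.
  by apply: (no_conjugate_slope_np det1 pos); lia.
- move=> /(slope_lt_p1_no_conjugate det1 twist) pos.
  exact: (no_conjugate_half_line det1 twist pos).
- case=> delta /(half_line_no_conjugate det1 twist) pos.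
  exact: (no_conjugate_green det1 pos).
Qed.
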